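(* The first-order theory of the structure $\langle\mathbb Q^+;\times\rangle$ is not finitely axiomatizable.
   Context: $\mathbb Q^+$ is the set of positive rational numbers, $\times$ is multiplication, and the language is $\{\times\}$. The theory of a structure is finitely axiomatizable if there is a finite set of sentences of the language whose logical consequences are exactly the sentences true in the structure. *)

(* Defs.v *)
From Stdlib Require List.
From mathcomp Require Import all_boot all_order all_algebra.
Set Implicit Arguments.
Unset Strict Implicit.
Unset Printing Implicit Defensive.
Import Order.TTheory GRing.Theory Num.Theory.

(* First-order logic with equality in the language with a single binary
   function symbol. Variables are de Bruijn indices: [Var 0] refers to the
   innermost enclosing quantifier. *)

Inductive term : Type :=
| Var (i : nat)
| Mul (s t : term).

Inductive formula : Type :=
| Equal (s t : term)
| Not (f : formula)
| And (f g : formula)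
| Or (f g : formula)
| Imp (f g : formula)
| All (f : formula)
| Ex (f : formula).

Fixpoint term_below (n : nat) (t : term) : bool :=
  match t with
  | Var i => i < n
  | Mul s t => term_below n s && term_below n t
  end.

(* All free variables of the formula are among the indices 0, ..., n - 1. *)
Fixpoint formula_below (n : nat) (f : formula) : bool :=
  match f with
  | Equal s t => term_below n s && term_below n t
  | Not f => formula_below n f
  | And f g | Or f g | Imp f g => formula_below n f && formula_below n g
  | All f | Ex f => formula_below n.+1 f
  end.

Definition sentence (f : formula) : bool := formula_below 0 f.

Record structure : Type := Structure {
  carrier :> Type;
  op : carrier -> carrier -> carrier;
  carrier_nonempty : inhabited carrier
}.

Definition env_cons (T : Type) (a : T) (e : nat -> T) (n : nat) : T :=
  if n is m.+1 then e m else a.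

Fixpoint eval (M : structure) (e : nat -> M) (t : term) : M :=
  match t with
  | Var i => e i
  | Mul s t => op (eval e s) (eval e t)
  end.

Fixpoint sat (M : structure) (e : nat -> M) (f : formula) : Prop :=
  match f with
  | Equal s t => eval e s = eval e t
  | Not f => ~ sat e f
  | And f g => sat e f /\ sat e g
  | Or f g => sat e f \/ sat e g
  | Imp f g => sat e f -> sat e g
  | All f => forall a : M, sat (env_cons a e) f
  | Ex f => exists a : M, sat (env_cons a e) f
  end.

(* On sentences the valuation is irrelevant; as the carrier is nonempty, a
   valuation exists, so quantifying over all of them is not vacuous. *)
Definition models (M : structure) (f : formula) : Prop :=
  forall e : nat -> M, sat e f.

Definition theory (M : structure) (f : formula) : Prop :=
  sentence f /\ models M f.

Definition consequence (Gamma : seq formula) (f : formula) : Prop :=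
  forall M : structure,
    (forall g, List.In g Gamma -> models M g) -> models M f.

Definition finitely_axiomatizable (T : formula -> Prop) : Prop :=
  exists Gamma : seq formula,
    (forall g, List.In g Gamma -> sentence g) /\
    (forall f, sentence f -> (consequence Gamma f <-> T f)).

Definition posrat : Type := {q : rat | (0 < q)%R}.

Definition posrat_mul (x y : posrat) : posrat :=
  exist _ (sval x * sval y)%R (mulr_gt0 (svalP x) (svalP y)).

Definition posrat_structure : structure :=
  @Structure posrat posrat_mul (inhabits (exist _ 1%R ltr01)).

(* Main.v *)
From HB Require Import structures.
From mathcomp Require Import all_boot all_order all_algebra.
From mathcomp Require Import boolp zify ring.
Require Import Defs.
Set Implicit Arguments.
Unset Strict Implicit.
Unset Printing Implicit Defensive.
Import Order.TTheory GRing.Theory Num.Theory.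
Local Open Scope ring_scope.

(** Why the theorem is true. Written additively, the positive rationals form a
    torsion-free abelian group G which is free on the primes. Suppose that
    finitely many true sentences axiomatize its theory, and take a prime [p]
    that is large compared with their quantifier depth and term sizes. The
    group H = G x Z/p satisfies the same axioms, since a short
    Ehrenfeucht-Fraisse game cannot detect torsion of such a large order; but
    the sentence saying that x |-> x^p is injective holds in G and fails in H.

    The game is played with the invariant [lin_equiv N]: two [n]-tuples, one in
    each group, satisfy the same integer linear relations with coefficients at
    most [N], and the same divisibilities by moduli at most [N] of such
    combinations. The heart of the proof is [extend_lin_equiv]: if two tuples are
    equivalent up to [step N], then every [a] in one group has a partner [b] in
    the other keeping the extended tuples equivalent up to [N].

    - If [a] satisfies a small relation k0 a = sum k_i e_i with k0 > 0, the same
      combination is divisible by [k0] on the other side, which defines [b]. After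
      multiplication by [k0], every question on the extended tuple becomes one
      on the old tuples, with coefficients and moduli of order N^2
      ([extend_dependent]).
    - Otherwise only divisibilities by divisors of L = N! matter. Let [d] be
      the order of [a] modulo L and the tuple, with d a = sum k_i e_i modulo L
      ([relative_order]). Choose [b0] with d b0 = sum k_i f_i exactly, and put
      b = b0 + (L / d) u, where [u] is independent of the tuple: there is a
      homomorphism to the integers with value 1 at [u] and 0 on the tuple. It
      shows that [b] satisfies no relation and has order exactly [d]
      ([extend_independent]).

    The only properties of the groups used are the absence of torsion of small
    order and the existence of elements such as [u]. In the positive rationals a
    prime dividing no numerator or denominator of the tuple serves as [u], its
    valuation being the homomorphism; composing with the first projection handles
    the product with Z/p. *)

(** * Bounded linear relations and divisibility in abelian groups *)

Definition group_structure (G : zmodType) : structure :=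
  @Structure G +%R (inhabits 0).

Section Lincomb.
Variable G : zmodType.
Implicit Types (x y a : G) (e : nat -> G) (k l : nat -> int) (m n N : nat).

Definition lincomb n k e : G := \sum_(i < n) e i *~ k i.

Definition divides m x : Prop := exists y, x = y *+ m.

Definition torsion_free_upto N : Prop :=
  forall m x, (0 < m <= N)%N -> x *+ m = 0 -> x = 0.

(** Applying the homomorphism [v] shows that a combination of [u] and the tuple
    that vanishes, or is divisible by some [m], has a coefficient at [u] that
    vanishes, or is divisible by [m]. *)
Definition has_fresh_elements : Prop :=
  forall n e, exists u (v : {additive G -> int}),
    v u = 1 /\ forall i, (i < n)%N -> v (e i) = 0.

Lemma lincomb0 n e : lincomb n (fun=> 0) e = 0.
Proof. by rewrite /lincomb big1. Qed.

Lemma lincombD n k l e :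
  lincomb n (fun i => k i + l i) e = lincomb n k e + lincomb n l e.
Proof.
by rewrite -big_split; apply: eq_bigr => i _; rewrite mulrzDr.
Qed.

Lemma lincombZ n k c e :
  lincomb n (fun i => c * k i) e = lincomb n k e *~ c.
Proof.
rewrite /lincomb mulrz_suml; apply: eq_bigr => i _.
by rewrite mulrC mulrzA.
Qed.

Lemma lincomb_cons n k a e :
  lincomb n.+1 k (env_cons a e) = a *~ k 0%N + lincomb n (k \o S) e.
Proof. by rewrite /lincomb big_ord_recl. Qed.

Lemma additive_lincomb0 n k e (v : {additive G -> int}) :
  (forall i, (i < n)%N -> v (e i) = 0) -> v (lincomb n k e) = 0.
Proof.
move=> v0; rewrite raddf_sum big1 // => i _.
by rewrite raddfMz v0 ?mul0rz.
Qed.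

Lemma dividesD m x y : divides m x -> divides m y -> divides m (x + y).
Proof. by move=> [z ->] [t ->]; exists (z + t); rewrite mulrnDl. Qed.

Lemma dividesN m x : divides m x -> divides m (- x).
Proof. by move=> [z ->]; exists (- z); rewrite mulNrn. Qed.

Lemma dividesDl m x y : divides m x -> (divides m (x + y) <-> divides m y).
Proof.
move=> mx; split=> [mxy|]; last exact: dividesD.
by rewrite -[y](addKr x); apply: dividesD => //; apply: dividesN.
Qed.

Lemma divides_mulz m x c : divides m x -> divides m (x *~ c).
Proof. by move=> [z ->]; exists (z *~ c); rewrite !pmulrn -!mulrzA mulrC. Qed.

Lemma torsion_free_inj N m x y :
  torsion_free_upto N -> (0 < m <= N)%N -> x *+ m = y *+ m -> x = y.
Proof.
move=> tf mN xy; apply/eqP; rewrite -subr_eq0; apply/eqP.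
by apply: tf mN _; rewrite mulrnBl xy subrr.
Qed.

Lemma divides_mul2 N m c x : torsion_free_upto N -> (0 < c <= N)%N ->
  divides (m * c) (x *+ c) <-> divides m x.
Proof.
move=> tf cN; split=> -[y xy]; exists y.
  by apply: (torsion_free_inj tf cN); rewrite xy mulrnA.
by rewrite xy mulrnA.
Qed.

Lemma divides_lincomb_modz n k e L : (0 < L)%N ->
  divides L (lincomb n k e) <-> divides L (lincomb n (fun i => (k i %% L)%Z) e).
Proof.
move=> L0.
have -> : lincomb n k e =
    lincomb n (fun i => L%:Z * (k i %/ L)%Z) e + lincomb n (fun i => (k i %% L)%Z) e.
  rewrite -lincombD; apply: eq_bigr => i _; congr (_ *~ _).
  by rewrite mulrC -divz_eq.
apply: dividesDl; rewrite lincombZ -pmulrn; by eexists.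
Qed.

(** The integers [c] such that [a *~ c] is, up to a multiple of [L], a combination
    of [e 0], ..., [e n.-1] form an ideal; [d] is its positive generator, and it
    divides [L] because [L] belongs to that ideal. *)
Lemma relative_order n a e L : (0 < L)%N -> exists d (k : nat -> int),
  [/\ (0 < d)%N, (d %| L)%N, divides L (a *+ d - lincomb n k e)
    & forall (c : int) l, divides L (a *~ c - lincomb n l e) -> (d%:Z %| c)%Z].
Proof.
move=> L0.
pose P d := (0 < d)%N && `[< exists k, divides L (a *+ d - lincomb n k e) >].
have PL : P L.
  rewrite /P L0; apply/asboolP; exists (fun=> 0); rewrite lincomb0 subr0.
  by exists a.
case: (ex_minnP (ex_intro P L PL)) => d /andP[d0 /asboolP[k dk]] dmin.
have dvd_min (c : int) l : divides L (a *~ c - lincomb n l e) -> (d%:Z %| c)%Z.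
  move=> cl; apply/dvdz_mod0P; apply/eqP; apply: contraT => r0.
  have dn0 : d%:Z != 0 by lia.
  have := ltz_mod c dn0; have := modz_ge0 c dn0.
  case Er: (c %% d)%Z r0 => [r|//] r0 _ rd.
  have /dmin : P r; last by lia.
  apply/andP; split; first by lia.
  apply/asboolP; exists (fun i => l i + (- (c %/ d)%Z) * k i).
  rewrite lincombD lincombZ.
  (* Subtracting a multiple of the relation for [d] leaves one for the remainder
     [r] of [c], which is smaller than [d]. *)
  suff -> : a *+ r - (lincomb n l e + lincomb n k e *~ (- (c %/ d)%Z)) =
      a *~ c - lincomb n l e + (a *+ d - lincomb n k e) *~ (- (c %/ d)%Z).
    by apply: dividesD => //; apply: divides_mulz.
  have -> : a *~ c = a *+ d *~ (c %/ d)%Z + a *+ r.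
    by rewrite {1}(divz_eq c d) Er mulrzDr mulrC mulrzA.
  rewrite !mulrNz mulrzBl !opprB -addrA [RHS]addrC.
  by rewrite [- _ + (_ - _)]addrA subrKA [RHS]addrC [- _ + _]addrC.
exists d, k; split=> //.
apply: (dvd_min L (fun=> 0)); rewrite lincomb0 subr0.
by exists a.
Qed.

End Lincomb.

(** The invariant of the game. The bound on coefficients and moduli is what lets
    torsion of large order go unnoticed. *)
Definition lin_equiv (G H : zmodType) N n (e : nat -> G) (f : nat -> H) : Prop :=
  forall k : nat -> int, (forall i, (i < n)%N -> (absz (k i) <= N)%N) ->
    (lincomb n k e = 0 <-> lincomb n k f = 0) /\
    forall m, (0 < m <= N)%N ->
      (divides m (lincomb n k e) <-> divides m (lincomb n k f)).

Lemma lin_equiv_sym (G H : zmodType) N n (e : nat -> G) (f : nat -> H) :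
  lin_equiv N n e f -> lin_equiv N n f e.
Proof.
move=> ef k kN; have [eq0 dv] := ef k kN.
by split=> [|m mN]; [rewrite eq0 | rewrite dv].
Qed.

Lemma lin_equiv_le (G H : zmodType) N N' n (e : nat -> G) (f : nat -> H) :
  (N <= N')%N -> lin_equiv N' n e f -> lin_equiv N n e f.
Proof.
move=> NN' ef k kN; have [|eq0 dv] := ef k.
  by move=> i /kN; lia.
by split=> // m mN; apply: dv; lia.
Qed.

(** For a fixed modulus [L] the coefficients matter only modulo [L], so the bound
    on them can be dropped. *)
Lemma lin_equiv_divides (G H : zmodType) N n (e : nat -> G) (f : nat -> H) L k :
  lin_equiv N n e f -> (0 < L <= N)%N ->
  divides L (lincomb n k e) <-> divides L (lincomb n k f).
Proof.
move=> ef LN; have L0 : (0 < L)%N by lia.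
rewrite divides_lincomb_modz // [X in _ <-> X]divides_lincomb_modz //.
apply: (ef _ _).2 => // i _.
have := modz_ge0 (k i) (_ : L%:Z != 0); have := ltz_mod (k i) (_ : L%:Z != 0).
by lia.
Qed.

(** * The extension property *)

(** The two summands serve the two cases of the extension property:
    clearing the leading coefficient of a relation produces coefficients up to
    2 N^2, and N! is a common multiple of all moduli up to [N]. *)
Definition step N : nat := ((N * N).*2 + N`!)%N.

Lemma leq_step N : (N <= step N)%N.
Proof. by rewrite /step; nia. Qed.

Section Extension.
Variables (G H : zmodType) (N n : nat) (e : nat -> G) (f : nat -> H).
Hypotheses (tfG : torsion_free_upto G (step N)) (tfH : torsion_free_upto H (step N)).
Hypothesis ef : lin_equiv (step N) n e f.
Variable a : G.

(** The relation determines [b], and multiplying by [k0], which reflects both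
    vanishing and divisibility, eliminates [a] and [b] from all conditions. *)
Lemma extend_dependent (k0 : nat) (k : nat -> int) : (0 < k0 <= N)%N ->
  (forall i, (i < n)%N -> (absz (k i) <= N)%N) ->
  a *+ k0 = lincomb n k e ->
  exists b : H, lin_equiv N n.+1 (env_cons a e) (env_cons b f).
Proof.
move=> k0N kN ak.
have NN : (N <= step N)%N := leq_step N.
have [b bk] : divides k0 (lincomb n k f).
  apply/(ef _).2; [by move=> i /kN; lia | lia |].
  by exists a.
exists b => l lN; rewrite !lincomb_cons.
(* [q] gives k0 (l0 a + sum l_(i+1) e_i) after substituting for k0 a. *)
pose q i := k0%:Z * l i.+1 + l 0%N * k i.
have qN i : (i < n)%N -> (absz (q i) <= step N)%N.
  move=> i_n; have := kN i i_n; have := lN 0%N isT; have := lN i.+1 i_n.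
  rewrite /q /step; set x := l i.+1; set y := l 0%N; set z := k i => xN yN zN.
  have := fact_gt0 N.
  have : (absz (k0%:Z * x)%R <= N * N)%N by rewrite abszM leq_mul //; lia.
  have : (absz (y * z)%R <= N * N)%N by rewrite abszM leq_mul.
  lia.
have scaled (K : zmodType) (c : K) (g : nat -> K) : c *+ k0 = lincomb n k g ->
    (c *~ l 0%N + lincomb n (l \o S) g) *+ k0 = lincomb n q g.
  move=> ck; rewrite /q lincombD !lincombZ -ck mulrnDl addrC; congr (_ + _).
  by rewrite !pmulrn -!mulrzA mulrC.
have [eq0 dv] := ef qN.
have k0S : (0 < k0 <= step N)%N by lia.
have eq0k (K : zmodType) (x : K) : torsion_free_upto K (step N) ->
    (x = 0 <-> x *+ k0 = 0).
  by move=> tf; split=> [->|/(tf k0)]; [rewrite mul0rn | apply].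
split=> [|m mN].
  rewrite (eq0k _ _ tfG) (eq0k _ _ tfH) (scaled _ _ _ ak) (scaled _ _ _ (esym bk)).
  exact: eq0.
rewrite -(divides_mul2 m _ tfG k0S) -(divides_mul2 m _ tfH k0S).
rewrite (scaled _ _ _ ak) (scaled _ _ _ (esym bk)); apply: dv.
have : (m * k0 <= N * N)%N by rewrite leq_mul //; lia.
have := fact_gt0 N.
by rewrite /step muln_gt0; lia.
Qed.

(** The partner [b] copies the behaviour of [a] modulo L = N!, while its fresh
    component (L / d) u keeps it from satisfying any linear relation and from
    having order smaller than [d] modulo [L]. *)
Lemma extend_independent : has_fresh_elements H ->
  (forall l : nat -> int, l 0%N != 0 ->
     (forall i, (i < n.+1)%N -> (absz (l i) <= N)%N) ->
     lincomb n.+1 l (env_cons a e) <> 0) ->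
  exists b : H, lin_equiv N n.+1 (env_cons a e) (env_cons b f).
Proof.
move=> fresh indep; pose L := N`!.
have L0 : (0 < L)%N := fact_gt0 N.
have LS : (0 < L <= step N)%N by rewrite L0 /step leq_addl.
have [d [k [d0 dL dk dmin]]] := relative_order n a e L0.
have dS : (0 < d <= step N)%N by have := dvdn_leq L0 dL; lia.
(* Here c = L / d. *)
have [c Lcd] := dvdnP dL.
have c0 : (0 < c)%N by move: L0; rewrite Lcd muln_gt0 => /andP[].
(* As [d] divides [L], it divides sum k_i e_i exactly, not only modulo L; this
   divisibility transfers to the other tuple. *)
have [b0 b0k] : divides d (lincomb n k f).
  apply/(lin_equiv_divides _ ef dS).
  case: dk => y dk; exists (a - y *+ c).
  by rewrite mulrnBl -mulrnA -Lcd -dk opprB addrC subrK.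
have [u [v [vu vf]]] := fresh n f.
have vb0 : v b0 = 0.
  have : v (b0 *+ d) = 0 by rewrite -b0k additive_lincomb0.
  by rewrite raddfMn => /eqP; rewrite mulrn_eq0 => /orP[|/eqP//]; lia.
pose b := b0 + u *+ c.
have vb (z : int) l : v (b *~ z + lincomb n l f) = c%:Z * z.
  rewrite raddfD raddfMz /b raddfD vb0 add0r raddfMn vu additive_lincomb0 // addr0.
  by lia.
have dkf : divides L (b *+ d - lincomb n k f).
  exists u; rewrite /b mulrnDl -b0k -mulrnA -Lcd addrC addrA.
  by rewrite addNr add0r.
have reduce (K : zmodType) (x : K) (g : nat -> K) (q : int) (l : nat -> int) :
    divides L (x *+ d - lincomb n k g) ->
    (divides L (x *~ (d%:Z * q) + lincomb n l g) <->
     divides L (lincomb n (fun i => q * k i + l i) g)).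
  move=> xk; rewrite lincombD lincombZ.
  have -> : x *~ (d%:Z * q) + lincomb n l g = (x *+ d - lincomb n k g) *~ q
      + (lincomb n k g *~ q + lincomb n l g).
    by rewrite mulrzBl addrA subrK pmulrn -mulrzA.
  by apply: dividesDl; apply: divides_mulz.
(* If [d] does not divide [z] neither side is divisible by [L]; if it does, the
   multiple of [a], or of [b], reduces to a combination of the old tuple. *)
have dvL (z : int) (l : nat -> int) :
    divides L (a *~ z + lincomb n l e) <-> divides L (b *~ z + lincomb n l f).
  have [/dvdzP[q zq]|dz] := boolP (d%:Z %| z)%Z.
    rewrite zq mulrC !reduce //; exact: lin_equiv_divides ef LS.
  split=> [al|[y bl]]; case/negP: dz.
    apply: (dmin _ (fun i => -1 * l i)); rewrite lincombZ mulrNz mulr1z opprK //.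
  have := vb z l; rewrite bl raddfMn Lcd => vy.
  apply/dvdzP; exists (v y).
  have c0' : c%:Z != 0 by lia.
  by apply: (mulfI c0'); rewrite -vy -mulr_natr natz PoszM; ring.
exists b => l lN; rewrite !lincomb_cons.
split=> [|m mN].
  have [l0|l0] := eqVneq (l 0%N) 0.
    rewrite l0 !mulr0z !add0r; apply: (ef _).1 => i i_n /=.
    by have := lN i.+1 i_n; have := leq_step N; lia.
  split=> [|/(congr1 v)].
    by rewrite -lincomb_cons => /(indep _ l0 lN).
  by rewrite vb raddf0; nia.
(* Multiplying by c' = L / m turns divisibility by [m] into divisibility by [L]. *)
have [c' Lc'] := dvdnP (dvdn_fact mN); rewrite -/L in Lc'.
have c'0 : (0 < c')%N by move: L0; rewrite Lc' muln_gt0 => /andP[].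
have c'S : (0 < c' <= step N)%N by rewrite c'0; move: LS; rewrite Lc'; nia.
rewrite -(divides_mul2 m _ tfG c'S) -(divides_mul2 m _ tfH c'S) mulnC -Lc'.
have expand (K : zmodType) (x : K) (g : nat -> K) :
    (x *~ l 0%N + lincomb n (l \o S) g) *+ c' =
    x *~ (l 0%N * c'%:Z) + lincomb n (fun i => c'%:Z * l i.+1) g.
  by rewrite lincombZ mulrnDl mulrzA -!pmulrn.
by rewrite !expand.
Qed.

(** The forth step of the game; the back step is the same lemma with the groups
    exchanged. *)
Lemma extend_lin_equiv : has_fresh_elements H ->
  exists b : H, lin_equiv N n.+1 (env_cons a e) (env_cons b f).
Proof.
move=> fresh; apply: contrapT => noext.
apply: (noext); apply: extend_independent => // l l0 lN rel; apply: noext.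
have l0N := lN 0%N isT.
(* Without an extension [a] must be dependent; the sign turns its coefficient
   into a natural number. *)
apply: (@extend_dependent (absz (l 0%N)) (fun i => - sgz (l 0%N) * l i.+1)).
- by lia.
- by move=> i /(lN i.+1); rewrite abszM abszN; case: sgzP l0; lia.
rewrite lincombZ; move: rel; rewrite lincomb_cons => /eqP.
rewrite addr_eq0 => /eqP al.
by rewrite pmulrn abszEsg mulrC mulrzA al mulNrz mulrNz.
Qed.

End Extension.

(** * Transfer of sentences *)

Fixpoint term_size (t : term) : nat :=
  match t with
  | Var _ => 1
  | Mul s t => term_size s + term_size t
  end.

(** The strength of [lin_equiv] that guarantees agreement on a formula: each
    quantifier costs one application of the extension property. *)
Fixpoint radius (f : formula) : nat :=
  match f with
  | Equal s t => term_size s + term_size t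
  | Not f => radius f
  | And f g | Or f g | Imp f g => maxn (radius f) (radius g)
  | All f | Ex f => step (radius f)
  end.

Fixpoint term_coef (t : term) (i : nat) : int :=
  match t with
  | Var j => (i == j)%:R
  | Mul s t => term_coef s i + term_coef t i
  end.

Lemma term_coef_le t i : (absz (term_coef t i) <= term_size t)%N.
Proof.
elim: t => [j|s IHs t IHt] /=; first by case: eqP.
by lia.
Qed.

Lemma eval_lincomb (G : zmodType) n t (e : nat -> G) : term_below n t ->
  eval (M := group_structure G) e t = lincomb n (term_coef t) e.
Proof.
elim: t => [j|s IHs t IHt] /=; last first.
  by case/andP=> /IHs -> /IHt ->; rewrite lincombD.
move=> jn; rewrite /lincomb (bigD1 (Ordinal jn)) //= eqxx mulr1z big1 ?addr0 //.
move=> i; rewrite -val_eqE /= => /negPf ->.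
by rewrite mulr0z.
Qed.

Section Transfer.
Variables (G H : zmodType) (P : nat).
Hypotheses (tfG : torsion_free_upto G P) (tfH : torsion_free_upto H P).
Hypotheses (freshG : has_fresh_elements G) (freshH : has_fresh_elements H).

Lemma torsion_free_le (K : zmodType) Q : (Q <= P)%N ->
  torsion_free_upto K P -> torsion_free_upto K Q.
Proof. by move=> QP tf m x mQ; apply: tf; lia. Qed.

(** The Ehrenfeucht-Fraisse argument: an equation between terms is a linear
    relation whose coefficients are bounded by the sizes of the terms, and a
    quantifier is matched by the extension property, used in both directions. *)
Lemma sat_lin_equiv g n (e : nat -> G) (f : nat -> H) :
  (radius g <= P)%N -> formula_below n g -> lin_equiv (radius g) n e f ->
  sat (M := group_structure G) e g <-> sat (M := group_structure H) f g.
Proof.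
elim: g n e f => [s t|g IH|g IHg h IHh|g IHg h IHh|g IHg h IHh|g IH|g IH]
  n e f /= rP.
- case/andP=> sn tn ef; rewrite !(@eval_lincomb _ n) //.
  have := (ef (fun i => term_coef s i + (-1) * term_coef t i) _).1.
  rewrite !lincombD !lincombZ !mulrN1z => eqst.
  have sub0 (K : zmodType) (x y : K) : x = y <-> x - y = 0.
    by split=> [->|/eqP]; rewrite ?subrr // subr_eq0 => /eqP.
  rewrite sub0 [X in _ <-> X]sub0; apply: eqst => i _.
  by have := term_coef_le s i; have := term_coef_le t i; lia.
- by move=> gn ef; rewrite (IH n e f).
- case/andP=> gn hn ef; rewrite (IHg n e f) ?(IHh n e f) //; try lia;
    by apply: lin_equiv_le ef; lia.
- case/andP=> gn hn ef; rewrite (IHg n e f) ?(IHh n e f) //; try lia;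
    by apply: lin_equiv_le ef; lia.
- case/andP=> gn hn ef; rewrite (IHg n e f) ?(IHh n e f) //; try lia;
    by apply: lin_equiv_le ef; lia.
- move=> gn ef; have rS := leq_step (radius g).
  have tfG' := torsion_free_le rP tfG; have tfH' := torsion_free_le rP tfH.
  split=> ag x.
    have [y xy] := extend_lin_equiv tfH' tfG' (lin_equiv_sym ef) x freshG.
    by apply/(IH n.+1 _ _ _ gn (lin_equiv_sym xy)); [lia | apply: ag].
  have [y xy] := extend_lin_equiv tfG' tfH' ef x freshH.
  by apply/(IH n.+1 _ _ _ gn xy); [lia | apply: ag].
- move=> gn ef; have rS := leq_step (radius g).
  have tfG' := torsion_free_le rP tfG; have tfH' := torsion_free_le rP tfH.
  split=> -[x xg].
    have [y xy] := extend_lin_equiv tfG' tfH' ef x freshH.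
    by exists y; apply/(IH n.+1 _ _ _ gn xy); [lia |].
  have [y xy] := extend_lin_equiv tfH' tfG' (lin_equiv_sym ef) x freshG.
  by exists y; apply/(IH n.+1 _ _ _ gn (lin_equiv_sym xy)); [lia |].
Qed.

(** Empty tuples are equivalent at every strength, so no comparison of elements is
    left for sentences. *)
Lemma models_transfer g : (radius g <= P)%N -> sentence g ->
  models (group_structure G) g -> models (group_structure H) g.
Proof.
move=> rP sg Gg f; apply/(sat_lin_equiv (e := fun=> 0) rP sg); last exact: Gg.
move=> k _; rewrite /lincomb !big_ord0; split=> // m _.
by split=> _; exists 0; rewrite mul0rn.
Qed.

End Transfer.

(** * The group of positive rationals *)

Lemma posrat_mulA : associative posrat_mul.
Proof. by move=> x y z; apply: val_inj; rewrite /= mulrA. Qed.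

Lemma posrat_mulC : commutative posrat_mul.
Proof. by move=> x y; apply: val_inj; rewrite /= mulrC. Qed.

Definition posrat_one : posrat := exist _ 1 ltr01.

Definition posrat_inv (x : posrat) : posrat :=
  exist _ (sval x)^-1 (etrans (invr_gt0 (sval x)) (svalP x)).

Lemma posrat_mul1 : left_id posrat_one posrat_mul.
Proof. by move=> x; apply: val_inj; rewrite /= mul1r. Qed.

Lemma posrat_mulV : left_inverse posrat_one posrat_inv posrat_mul.
Proof. by move=> x; apply: val_inj; rewrite /= mulVf // lt0r_neq0 // (svalP x). Qed.

HB.instance Definition _ := Choice.on posrat.
HB.instance Definition _ :=
  GRing.isZmodule.Build posrat posrat_mulA posrat_mulC posrat_mul1 posrat_mulV.

Lemma val_posrat_mulrn (x : posrat) m : sval (x *+ m) = sval x ^+ m.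
Proof. by elim: m => // m IH; rewrite mulrS exprS -IH. Qed.

Lemma posrat_torsion_free N : torsion_free_upto posrat N.
Proof.
move=> m x /andP[m0 _] /(congr1 sval); rewrite val_posrat_mulrn /= => /eqP.
rewrite pexpr_eq1 ?(ltW (svalP x)) //.
by move=> /eqP x1; apply: val_inj.
Qed.

Section Valuation.
Variable p : nat.

Definition valuation (x : posrat) : int :=
  (logn p `|numq (sval x)|)%:Z - (logn p `|denq (sval x)|)%:Z.

Lemma valuation_is_additive : {morph valuation : x y / x + y}.
Proof.
move=> x y; rewrite /valuation.
have xy : sval (x + y) = sval x * sval y by [].
have := svalP (x + y); have := svalP x; have := svalP y.
rewrite {}xy; move: (sval x) (sval y) => q r r0 q0 qr0.
have := denq_gt0 q; have := denq_gt0 r; have := denq_gt0 (q * r).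
move: (q0) (r0) (qr0); rewrite -(numq_gt0 q) -(numq_gt0 r) -(numq_gt0 (q * r)).
move=> nq nr nqr dqr dr dq.
have : numq (q * r) * (denq q * denq r) = numq q * numq r * denq (q * r).
  apply: (intr_inj (R := rat)); rewrite !intrM !numqE; ring.
move/(congr1 (fun z => logn p (absz z))).
by rewrite !abszM !lognM; lia.
Qed.

Lemma valuation_zmod : zmod_morphism valuation.
Proof.
by move=> x y; apply: (addIr (valuation y)); rewrite -valuation_is_additive !subrK.
Qed.

HB.instance Definition _ :=
  GRing.isZmodMorphism.Build posrat int valuation valuation_zmod.

End Valuation.

(** A prime exceeding every numerator and denominator in the tuple is fresh, as
    witnessed by its valuation. *)
Lemma posrat_fresh : has_fresh_elements posrat.
Proof.
move=> n e.
pose h (x : posrat) := (`|numq (sval x)| + `|denq (sval x)|)%N.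
have [p p_big p_prime] := prime_above (\max_(i < n) h (e i)).
have p0 : 0 < p%:Q by rewrite ltr0z; have := prime_gt0 p_prime; lia.
exists (exist _ p%:Q p0), (valuation p); split=> [|i i_n].
  by rewrite /= /valuation /= numq_int denq_int logn1 -[absz p]expn1 pfactorK.
have := leq_bigmax (F := fun i : 'I_n => h (e i)) (Ordinal i_n).
rewrite /= /valuation /h => /leq_ltn_trans/(_ p_big) hp.
have small m : (0 < m < p)%N -> logn p m = 0%N.
  case/andP=> m0 mp; rewrite lognE; case: ifP => // /and3P[_ _ /dvdn_leq].
  by lia.
have := svalP (e i); rewrite -numq_gt0 => ne; have de := denq_gt0 (sval (e i)).
by rewrite !small //; lia.
Qed.

(** * The product with a cyclic group of large prime order *)

Lemma fresh_pair (G K : zmodType) :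
  has_fresh_elements G -> has_fresh_elements (G * K)%type.
Proof.
move=> fresh n e; have [u [v [vu ve]]] := fresh n (fst \o e).
by exists (u, 0), (v \o fst).
Qed.

Lemma torsion_free_pair (G K : zmodType) N : torsion_free_upto G N ->
  torsion_free_upto K N -> torsion_free_upto (G * K)%type N.
Proof.
move=> tfG tfK m x mN /eqP; rewrite -pair_eqE /= => /andP[].
rewrite raddfMn [(x *+ m).2]raddfMn => /eqP/(tfG _ _ mN) x1 /eqP/(tfK _ _ mN) x2.
by apply/eqP; rewrite -pair_eqE /= x1 x2 !eqxx.
Qed.

Lemma torsion_free_Fp p N : prime p -> (N < p)%N -> torsion_free_upto 'F_p N.
Proof.
move=> p_prime Np m x mN; rewrite -mulr_natr => /eqP; rewrite mulf_eq0.
case/orP=> [/eqP//|].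
rewrite -(dvdn_pcharf (pchar_Fp p_prime)) => /dvdn_leq; lia.
Qed.

(** * A sentence detecting p-torsion *)

(** The language has no constant for 1, so powers start at exponent 1:
    [term_pow t m] is t^(m+1). *)
Fixpoint term_pow (t : term) m : term :=
  if m is m'.+1 then Mul t (term_pow t m') else t.

(** In a group, this says that there is no (m+1)-torsion; it is phrased as the
    injectivity of a power map because the identity cannot be named. *)
Definition pow_injective m : formula :=
  All (All (Imp (Equal (term_pow (Var 0) m) (term_pow (Var 1) m))
                (Equal (Var 0) (Var 1)))).

Lemma eval_pow (G : zmodType) e t m :
  eval (M := group_structure G) e (term_pow t m) =
  (eval (M := group_structure G) e t : G) *+ m.+1.
Proof. by elim: m => [|m IH] //=; rewrite IH [RHS]mulrS. Qed.

Lemma sentence_pow_injective m : sentence (pow_injective m).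
Proof.
rewrite /sentence /=.
have below i : (i < 2)%N -> term_below 2 (term_pow (Var i) m).
  by move=> i2; elim: m => //= m ->; rewrite i2.
by rewrite !below.
Qed.

Lemma models_pow_injective (G : zmodType) m :
  models (group_structure G) (pow_injective m) <-> forall x : G, x *+ m.+1 = 0 -> x = 0.
Proof.
split=> [inj x xm|tf e a b /=].
  by apply: (inj (fun=> 0) 0 x); rewrite !eval_pow /= xm mul0rn.
rewrite !eval_pow /= => ab; apply/eqP; rewrite -subr_eq0; apply/eqP/tf.
by rewrite mulrnBl ab subrr.
Qed.

Theorem theorem4p12 : ~ finitely_axiomatizable (theory posrat_structure).
Proof.
move=> [Gamma [sGamma axiom]].
have Gamma_true g : List.In g Gamma -> models posrat_structure g.
  move=> gG; apply: (proj1 (axiom g (sGamma g gG)) _).2.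
  by move=> M; apply.
have [N leN] : exists N, forall g, List.In g Gamma -> (radius g <= N)%N.
  elim: (Gamma) => [|h l [N leN]]; first by exists 0%N.
  exists (maxn (radius h) N) => g /= [<-|/leN]; lia.
have [p Np p_prime] := prime_above N.
pose H := (posrat * 'F_p)%type : zmodType.
have H_Gamma g : List.In g Gamma -> models (group_structure H) g.
  move=> gG; apply: (models_transfer (G := posrat) (P := N)).
  - exact: posrat_torsion_free.
  - apply: torsion_free_pair; first exact: posrat_torsion_free.
    exact: torsion_free_Fp.
  - exact: posrat_fresh.
  - by apply: fresh_pair; apply: posrat_fresh.
  - exact: leN.
  - exact: sGamma.
  - exact: Gamma_true.
have p0 := prime_gt0 p_prime.
have posrat_pow : models posrat_structure (pow_injective p.-1).
  apply/(models_pow_injective posrat) => x; rewrite prednK //.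
  by apply: (@posrat_torsion_free p); rewrite p0 leqnn.
have H_pow : models (group_structure H) (pow_injective p.-1).
  have sp := sentence_pow_injective p.-1.
  exact: (proj2 (axiom _ sp) (conj sp posrat_pow) _ H_Gamma).
(* The element (0, 1) has order [p] and refutes the sentence in H. *)
have /(congr1 snd)/eqP : ((0, 1) : H) = 0; last by rewrite oner_eq0.
apply: (models_pow_injective H _).1 H_pow _ _; rewrite prednK //.
apply/eqP; rewrite -pair_eqE /= raddfMn [(_ *+ _).2]raddfMn /= mul0rn eqxx.
by rewrite (pcharf0 (pchar_Fp p_prime)).
Qed.
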